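(* Over all unweighted directed graphs $G$ of order $n$ with maximum indegree $d$ and $\operatorname{ept}_{\mathrm{rzf}}(G)<\infty$ (for $n,d$ such that at least one such graph exists), the maximum possible value of $\operatorname{ept}_{\mathrm{rzf}}(G)$ is $dn-\frac{d(d+1)}{2}$.
   Context: Directed graphs are finite, without loops or multiple edges (edges in both directions between two vertices are allowed). The order is the number of vertices. Randomized zero forcing (RZF) on an unweighted directed graph $G$: start with blue set $B_0$. Given the blue set $B_t$, each white vertex $w\notin B_t$ independently becomes blue at round $t+1$ with probability equal to (number of in-neighbors of $w$ in $B_t$)/(indegree of $w$), and with probability $0$ if $w$ has indegree $0$; blue vertices stay blue forever. $\operatorname{ept}_{\mathrm{rzf}}(G,v)$ is the expected value of $\tau=\min\{t: B_t=V(G)\}$ started from $B_0=\{v\}$ if it is possible to color all of $G$ blue from $\{v\}$, and $\infty$ otherwise. $\operatorname{ept}_{\mathrm{rzf}}(G)=\min_{v\in V(G)}\operatorname{ept}_{\mathrm{rzf}}(G,v)$. *)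

(* Defs.v *)
From mathcomp Require Import all_boot all_order all_algebra.
From mathcomp Require Import boolp reals constructive_ereal ereal.
From mathcomp Require Import topology normedtype sequences.

Set Implicit Arguments.
Unset Strict Implicit.
Unset Printing Implicit Defensive.

Import Order.TTheory GRing.Theory Num.Theory.

Local Open Scope ring_scope.

Record digraph := Digraph {
  vertex :> finType;
  arc : rel vertex; (* [arc u w] is an edge from [u] to [w] *)
  arc_irr : irreflexive arc }.

Definition in_nbrs (G : digraph) (w : G) : {set G} := [set u : G | arc u w].

Definition indeg (G : digraph) (w : G) : nat := #|in_nbrs w|.

Definition max_indeg (G : digraph) : nat := (\max_(w : G) indeg w)%N.

Section RandomizedZeroForcing.
Variables (R : realType) (G : digraph).

Definition force_prob (B : {set G}) (w : G) : R :=
  if indeg w == 0%N then 0 else #|in_nbrs w :&: B|%:R / (indeg w)%:R.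

(* Transition probability P(B_{t+1} = C | B_t = B): the white vertices make
   independent choices and the blue ones stay blue. *)
Definition rzf_step (B C : {set G}) : R :=
  if B \subset C then
    \prod_(w in ~: B)
      (if w \in C then force_prob B w else 1 - force_prob B w)
  else 0.

(* Probability that (B_0, ..., B_t) = b when the process starts at {v}. *)
Definition path_prob (v : G) (t : nat) (b : t.+1.-tuple {set G}) : R :=
  (nth set0 b 0 == [set v])%:R *
  \prod_(i < t) rzf_step (nth set0 b i) (nth set0 b i.+1).

(* Probability of an event depending only on (B_0, ..., B_t). *)
Definition rzf_prob (v : G) (t : nat) (E : pred (t.+1.-tuple {set G})) : R :=
  \sum_(b | E b) path_prob v b.

(* The event tau = t, where tau = min {t : B_t = V(G)}. *)
Definition tau_is (t : nat) : pred (t.+1.-tuple {set G}) :=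
  fun b => [forall i : 'I_t.+1, (tnth b i == [set: G]) == (i == t :> nat)].

Definition tau_pmf (v : G) (t : nat) : R := rzf_prob v (@tau_is t).

(* Expectation of tau as a random variable in {0, 1, 2, ...} U {oo}; the last
   term is oo * P(tau = oo), with the convention oo * 0 = 0. *)
Definition expected_tau (v : G) : \bar R :=
  (\sum_(0 <= t <oo) (t%:R * tau_pmf v t)%:E
   + +oo * (1 - \sum_(0 <= t <oo) (tau_pmf v t)%:E))%E.

Definition can_color_all (v : G) : Prop :=
  exists t : nat,
    0 < rzf_prob v (fun b : t.+1.-tuple {set G} => tnth b ord_max == [set: G]).

Definition ept_from (v : G) : \bar R :=
  if `[< can_color_all v >] then expected_tau v else +oo%E.

Definition ept : \bar R := \big[Order.min/+oo%E]_(v : G) ept_from v.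

End RandomizedZeroForcing.

(* Digraphs of order [n] with maximum indegree [d] and finite expected
   propagation time. *)
Definition admissible (R : realType) (n d : nat) (G : digraph) : Prop :=
  [/\ #|G| = n, max_indeg G = d & (ept R G < +oo)%E].

(* Main.v *)
Require Import Defs.
From mathcomp Require Import all_boot all_order all_algebra.
From mathcomp Require Import reals constructive_ereal.
From mathcomp Require Import boolp ereal topology normedtype sequences.
From mathcomp Require Import zify ring lra.

Import Order.TTheory GRing.Theory Num.Theory.
Import numFieldNormedType.Exports.
Local Open Scope ring_scope.

(* With i white vertices left and the start able to color everything, some
   white vertex u has a blue in-neighbour.  The white in-neighbours of u are
   among the other i - 1 white vertices, so u is forced with probability at
   least 1 / min(i, d).  Hence the potential sum_(i <= w) min(i, d) of a
   state with w white vertices decreases by at least 1 on average at each step,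
   which bounds the expected time by sum_(i < n) min(i, d) = dn - d(d+1)/2.
   All of this is an equality on the chain 0 -> 1 -> ... -> n-1 in which every
   j > 0 also receives arcs from its d - 1 successors (those that exist): the
   blue set started at 0 is always an initial segment, and only its successor
   can be forced.  As 0 has indegree 0, it is the only start that can color
   the chain. *)

(** * One-step transition probabilities *)

Section Transition.
Variables (R : realType) (G : digraph).
Implicit Types (B C : {set G}) (w : G).

Local Notation P := (@rzf_step R G).

Lemma force_prob_ge0 B w : 0 <= force_prob R B w.
Proof. by rewrite /force_prob; case: ifP => // _; rewrite divr_ge0. Qed.

Lemma force_prob_le1 B w : force_prob R B w <= 1.
Proof.
rewrite /force_prob; case: ifPn => // d0.
rewrite ler_pdivrMr ?ltr0n ?lt0n// mul1r ler_nat.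
by rewrite subset_leq_card// subsetIl.
Qed.

(** A product over all vertices, with factor 0 when a blue vertex turns white, can be summed over
    all [C] by distributivity. *)
Lemma rzf_stepE B C :
  P B C = \prod_w (if w \in C then if w \in B then 1 else force_prob R B w
                   else if w \in B then 0 else 1 - force_prob R B w).
Proof.
rewrite /rzf_step [RHS](bigID (mem B))/=; case: ifPn => [sBC|].
  rewrite [X in _ = X * _]big1 ?mul1r => [|w wB]; last first.
    by rewrite (subsetP sBC) ?wB.
  apply: eq_big => [w|w]; first by rewrite inE.
  by rewrite inE => /negPf->.
by case/subsetPn => w wB /negPf wC; rewrite (bigD1 w)//= wC wB !mul0r.
Qed.

Lemma rzf_step_ge0 B C : 0 <= P B C.
Proof.
rewrite rzf_stepE prodr_ge0// => w _.
by do !case: ifP => // _; rewrite ?force_prob_ge0// subr_ge0 force_prob_le1.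
Qed.

Lemma rzf_step_neq0 B C : P B C != 0 ->
  B \subset C /\ forall w, w \in C -> w \notin B -> force_prob R B w != 0.
Proof.
move=> PBC; have sBC : B \subset C.
  by apply: contraNT PBC => /negPf sBC; rewrite /rzf_step sBC.
split=> // w wC /negPf wB; apply: contraNneq PBC => fw0.
by rewrite rzf_stepE (bigD1 w)//= wC wB fw0 mul0r.
Qed.

Lemma sum_rzf_step B : \sum_C P B C = 1.
Proof.
under eq_bigr do rewrite rzf_stepE.
by rewrite -bigA_distr/= big1// => w _; case: ifP; rewrite ?addr0// addrC subrK.
Qed.

(* Replacing the factor of [u] for the outcome "[u] stays white" by 0 in the
   product formula selects the sets containing [u]. *)
Lemma sum_rzf_step_mem B u : u \notin B ->
  \sum_(C : {set G} | u \in C) P B C = force_prob R B u.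
Proof.
move=> /negPf uB; pose F w := if w \in B then 1 else force_prob R B w.
pose H w := if w \in B then 0 else 1 - force_prob R B w.
transitivity (\sum_(C : {set G})
    \prod_w (if w \in C then F w else if w == u then 0 else H w)).
  rewrite big_mkcond/=; apply: eq_bigr => C _; case: ifPn => uC.
    rewrite rzf_stepE; apply: eq_bigr => w _.
    by case: ifPn => // wC; case: eqP => // wu; rewrite -wu (negPf wC) in uC.
  by rewrite (bigD1 u)//= (negPf uC) eqxx mul0r.
rewrite -bigA_distr/= (bigD1 u)//= eqxx addr0 big1 ?mulr1 ?/F ?uB// => w /negPf->.
by rewrite /H; case: ifP; rewrite ?addr0// addrC subrK.
Qed.

Lemma le_sum_rzf_step B (f g : {set G} -> R) :
  (forall C, P B C != 0 -> f C <= g C) ->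
  \sum_C P B C * f C <= \sum_C P B C * g C.
Proof.
move=> fg; apply: ler_sum => C _; have [->|/fg] := eqVneq (P B C) 0.
  by rewrite !mul0r.
by move=> fgC; rewrite ler_wpM2l// rzf_step_ge0.
Qed.

(** The potential after one step will be compared with [a - c * (u \in C)], whose mean involves only
    the probability that [u] is forced. *)
Lemma sum_rzf_step_mem_sub B u (a c : R) : u \notin B ->
  \sum_C P B C * (a - c * (u \in C)%:R) = a - c * force_prob R B u.
Proof.
move=> uB; under eq_bigr do rewrite mulrBr mulrCA.
rewrite sumrB -mulr_suml sum_rzf_step mul1r -mulr_sumr; congr (_ - _ * _).
rewrite -sum_rzf_step_mem// [RHS]big_mkcond/=; apply: eq_bigr => C _.
by case: ifP; rewrite ?mulr1 ?mulr0.
Qed.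

(** * The law of the coloring time by first-step recursion *)

(** For the process started at [B], [hit t B] is P(tau = t) and [surv t B] below is P(tau > t). *)
Fixpoint hit t B : R :=
  if t is t'.+1 then (B != [set: G])%:R * \sum_C P B C * hit t' C
  else (B == [set: G])%:R.

Fixpoint surv t B : R :=
  if t is t'.+1 then (B != [set: G])%:R * \sum_C P B C * surv t' C
  else (B != [set: G])%:R.

#[local] Arguments hit : simpl never.
#[local] Arguments surv : simpl never.

Lemma hit_step t B :
  hit t.+1 B = (B != [set: G])%:R * \sum_C P B C * hit t C.
Proof. by []. Qed.

Lemma surv0 B : surv 0 B = (B != [set: G])%:R.
Proof. by []. Qed.

Lemma surv_step t B :
  surv t.+1 B = (B != [set: G])%:R * \sum_C P B C * surv t C.
Proof. by []. Qed.

Lemma hit_ge0 t B : 0 <= hit t B.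
Proof.
elim: t B => [|t IH] B; first exact: ler0n.
by rewrite hit_step mulr_ge0// sumr_ge0// => C _; rewrite mulr_ge0// rzf_step_ge0.
Qed.

Lemma surv_ge0 t B : 0 <= surv t B.
Proof.
elim: t B => [|t IH] B; first exact: ler0n.
by rewrite surv_step mulr_ge0// sumr_ge0// => C _; rewrite mulr_ge0// rzf_step_ge0.
Qed.

Lemma hitS t B : hit t.+1 B = surv t B - surv t.+1 B.
Proof.
elim: t B => [|t IH] B.
  rewrite surv_step hit_step /surv /hit.
  case: eqP => _; rewrite ?mul0r ?subrr// !mul1r.
  rewrite -[X in X - _](sum_rzf_step B) -sumrB; apply: eq_bigr => C _.
  by case: eqP => _; rewrite ?mulr1 ?mulr0 ?subr0 ?subrr.
rewrite hit_step [X in X - _]surv_step [X in _ - X]surv_step -mulrBr -sumrB.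
by congr (_ * _); apply: eq_bigr => C _; rewrite -mulrBr -IH.
Qed.

Lemma surv_ninc t B : surv t.+1 B <= surv t B.
Proof. by rewrite -subr_ge0 -hitS hit_ge0. Qed.

Lemma sum_hit t B : \sum_(k < t.+1) hit k B = 1 - surv t B.
Proof.
elim: t => [|t IH]; last by rewrite big_ord_recr/= IH hitS; ring.
by rewrite big_ord1 /hit /surv/=; case: eqP; rewrite ?subr0 ?subrr.
Qed.

(** Summation by parts: the mean of tau on the event tau <= t is E[min(tau, t)] - t P(tau > t). *)
Lemma sum_mul_hit t B :
  \sum_(k < t.+1) k%:R * hit k B = \sum_(k < t) surv k B - t%:R * surv t B.
Proof.
elim: t => [|t IH]; first by rewrite big_ord1 big_ord0 !mul0r subr0.
rewrite big_ord_recr/= IH hitS [in RHS]big_ord_recr/=.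
by rewrite -!natr1; ring.
Qed.

Lemma survT t : surv t [set: G] = 0.
Proof. by case: t => [|t]; rewrite ?surv_step /surv ?eqxx ?mul0r. Qed.

(* Optional stopping: a potential decreasing by at least (resp. at most) 1 on
   average at each step bounds the truncated expectations
   [\sum_(k < t) surv k B] = E[min(tau, t)] from above (resp. below). *)
Lemma sum_surv_le (I : pred {set G}) (f : {set G} -> R) t B :
  (forall B C, I B -> P B C != 0 -> I C) -> (forall B, 0 <= f B) ->
  (forall B, I B -> B != [set: G] -> \sum_C P B C * f C <= f B - 1) ->
  I B -> \sum_(k < t) surv k B <= f B.
Proof.
move=> Istep f0 fdrift; elim: t B => [|t IH] B IB; first by rewrite big_ord0.
have [->|BT] := eqVneq B setT; first by rewrite big1// => k _; rewrite survT.
rewrite big_ord_recl surv0 BT -lerBrDl; apply: le_trans (fdrift _ IB BT).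
under eq_bigr do rewrite surv_step BT mul1r.
rewrite exchange_big/=; under eq_bigr do rewrite -mulr_sumr.
by apply: le_sum_rzf_step => C /(Istep _ _ IB)/IH.
Qed.

(** The term [c * surv t B] pays for the truncation: the potential left at time t is at most [c],
    and at most 0 once everything is blue. The invariant [I] restricts the drift condition to
    reachable states. *)
Lemma le_sum_surv (I : pred {set G}) (f : {set G} -> R) c t B :
  (forall B C, I B -> P B C != 0 -> I C) -> (forall B, f B <= c) ->
  f [set: G] <= 0 ->
  (forall B, I B -> B != [set: G] -> f B - 1 <= \sum_C P B C * f C) ->
  I B -> f B <= \sum_(k < t) surv k B + c * surv t B.
Proof.
move=> Istep fc fT fdrift; elim: t B => [|t IH] B IB.
  have [->|BT] := eqVneq B setT; first by rewrite big_ord0 survT mulr0 addr0.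
  by rewrite big_ord0 add0r /surv BT mulr1.
have [->|BT] := eqVneq B setT.
  by rewrite big1 => [|k _]; rewrite survT// mulr0 addr0.
rewrite big_ord_recl surv0 BT -addrA -lerBlDl.
apply: (le_trans (fdrift _ IB BT)).
under [X in X + _]eq_bigr do rewrite surv_step BT mul1r.
rewrite surv_step BT mul1r exchange_big/= mulr_sumr -big_split/=.
rewrite [leRHS](_ : _ =
  \sum_C P B C * (\sum_(k < t) surv k C + c * surv t C)); last first.
  by apply: eq_bigr => C _; rewrite mulrDr mulr_sumr mulrCA.
by apply: le_sum_rzf_step => C /(Istep _ _ IB)/IH.
Qed.

End Transition.

Arguments hit R {G} t B : simpl never.
Arguments surv R {G} t B : simpl never.

(** * From trajectories to the expected time *)

Section ExpectedTime.
Variables (R : realType) (G : digraph).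
Local Open Scope classical_set_scope.
Implicit Types (B C : {set G}) (v w : G).

Local Notation P := (@rzf_step R G).

Lemma tau_is_cons t B (c : t.+1.-tuple {set G}) :
  tau_is [tuple of B :: c] = (B != [set: G]) && tau_is c.
Proof.
apply/forallP/andP => [tauc|[BT /forallP tauc] i].
  split; first by have := tauc ord0; rewrite tnth0 eqbF_neg.
  by apply/forallP => i; have := tauc (lift ord0 i); rewrite tnthS.
by case: (unliftP ord0 i) => [j|] ->; rewrite ?tnthS ?tnth0 ?eqbF_neg.
Qed.

(** Identifies the sum over trajectories with the recursion: a trajectory is its first state
    followed by a shorter trajectory. *)
Lemma sum_tau_is t B :
  \sum_(b : t.+1.-tuple {set G} | tau_is b) (nth set0 b 0 == B)%:R *
    \prod_(i < t) P (nth set0 b i) (nth set0 b i.+1) = hit R t B.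
Proof.
elim: t B => [|t IH] B; rewrite big_mkcond/=.
  rewrite (reindex (fun A : {set G} => [tuple A]))/=; last first.
    exists (fun b => thead b) => [A _//|b _].
    by apply/val_inj; case: b => [[|A []]].
  rewrite (bigD1 B)//= [X in _ + X]big1 ?addr0 => [|A /negPf->]; last first.
    by rewrite mul0r if_same.
  rewrite big_ord0 mulr1 (eqxx B); suff -> : tau_is [tuple B] = (B == setT).
    by rewrite /hit; case: (B == _).
  apply/forallP/idP => [/(_ ord0)|BT i]; first by rewrite tnth0 eqb_id.
  by rewrite (ord1 i) tnth0 BT.
rewrite (reindex (fun p : {set G} * t.+1.-tuple {set G} =>
    [tuple of p.1 :: p.2]))/=; last first.
  exists (fun b => (thead b, [tuple of behead b])) => [[A c] _|b _] /=.
    by congr (_, _); apply/val_inj.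
  by rewrite [RHS]tuple_eta.
rewrite -(pair_bigA _ (fun A (c : t.+1.-tuple {set G}) =>
  if tau_is [tuple of A :: c] then (A == B)%:R *
    \prod_(i < t.+1) P (nth set0 (A :: c) i) (nth set0 (A :: c) i.+1) else 0))/=.
rewrite (bigD1 B)//= [X in _ + X]big1 ?addr0 => [|A /negPf->]; last first.
  by rewrite big1// => c _; rewrite mul0r if_same.
rewrite hit_step; under [in RHS]eq_bigr do rewrite -IH mulr_sumr.
rewrite exchange_big/= mulr_sumr [RHS]big_mkcond/=; apply: eq_bigr => c _.
rewrite tau_is_cons; case: (tau_is c); rewrite ?andbF// andbT (eqxx B) mul1r.
(* For fixed [c], the indicator keeps only the successor state equal to the head of [c]. *)
rewrite (bigD1 (nth set0 c 0))//= [X in _ + X]big1 ?addr0 => [|A]; last first.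
  by rewrite eq_sym => /negPf->; rewrite mul0r mulr0.
rewrite eqxx mul1r big_ord_recl/=.
by case: (B != _); rewrite ?mul1r ?mul0r.
Qed.

Lemma tau_pmfE v t : tau_pmf R v t = hit R t [set v].
Proof. by rewrite -sum_tau_is. Qed.

Lemma surv_le k t B : (k <= t)%N -> surv R t B <= surv R k B.
Proof.
elim: t => [|t IH]; first by rewrite leqn0 => /eqP->.
rewrite leq_eqVlt ltnS => /predU1P[->//|/IH].
by apply: le_trans; rewrite surv_ninc.
Qed.

(** Both sides sum the differences [surv k B - surv N B], which are nonnegative for k < N. *)
Lemma le_sum_sub_surv t N B : (t <= N)%N ->
  \sum_(k < t) surv R k B - t%:R * surv R N B <=
  \sum_(k < N) surv R k B - N%:R * surv R N B.
Proof.
have subE M : \sum_(k < M) surv R k B - M%:R * surv R N B =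
    \sum_(0 <= k < M) (surv R k B - surv R N B).
  by rewrite sumrB big_const_nat subn0 iter_addr_0 mulr_natl big_mkord.
move=> tN; rewrite !subE [leRHS](big_cat_nat _ tN)//= lerDl big_nat_cond.
by apply: sumr_ge0 => k /andP[/andP[_ /ltnW kN] _]; rewrite subr_ge0 surv_le.
Qed.

(** Since [surv] is nonincreasing in time, (t + 1) P(tau > t) is at most the sum of the first t + 1
    terms, hence at most [c]. *)
Lemma surv_cvg0 B c : (forall t, \sum_(k < t) surv R k B <= c) ->
  (fun t => surv R t B) @ \oo --> (0 : R).
Proof.
move=> sc; apply: (@squeeze_cvgr _ _ _ _ (fun=> 0) (fun t => c * harmonic t)).
- apply: nearW => t; rewrite surv_ge0/= /harmonic/= ler_pdivlMr ?ltr0n//.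
  apply: le_trans (sc t.+1); rewrite mulr_natr -[X in _ *+ X]card_ord -sumr_const.
  by apply: ler_sum => k _; rewrite surv_le// -ltnS.
- exact: cvg_cst.
- by rewrite -[X in _ --> X](mulr0 c); apply: cvgMl_tmp; exact: cvg_harmonic.
Qed.

Lemma sum_hit_eq1 B c : (forall t, \sum_(k < t) surv R k B <= c) ->
  (\sum_(0 <= t <oo) (hit R t B)%:E = 1)%E.
Proof.
move=> sc; apply/cvg_lim => //; rewrite -cvg_shiftS/=.
under eq_cvg do rewrite sumEFin big_mkord sum_hit.
apply/cvg_EFin; first exact: nearW.
rewrite -[X in _ --> X](subr0 1); apply: cvgB; first exact: cvg_cst.
exact: surv_cvg0 sc.
Qed.

(** Here tau is almost surely finite, so the infinite term is oo * 0 = 0. *)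
Lemma expected_tauE v c : (forall t, \sum_(k < t) surv R k [set v] <= c) ->
  expected_tau R v = (\sum_(0 <= t <oo) (t%:R * hit R t [set v])%:E)%E.
Proof.
move=> sc; have pmf : tau_pmf R v = fun t => hit R t [set v].
  by apply/funext => t; rewrite tau_pmfE.
by rewrite /expected_tau pmf (sum_hit_eq1 _ _ sc) subee// mule0 adde0.
Qed.

Lemma expected_tau_le v c : (forall t, \sum_(k < t) surv R k [set v] <= c) ->
  (expected_tau R v <= c%:E)%E.
Proof.
move=> sc; rewrite (expected_tauE _ _ sc); apply: lime_le.
  by apply: is_cvg_nneseries => t _ _; rewrite lee_fin mulr_ge0// hit_ge0.
apply: nearW => t; apply: (@le_trans _ _
  (\sum_(0 <= k < t.+1) (k%:R * hit R k [set v])%:E)%E).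
  by rewrite big_nat_recr//= leeDl// lee_fin mulr_ge0// hit_ge0.
rewrite sumEFin lee_fin big_mkord sum_mul_hit; apply: le_trans (sc t).
by rewrite gerBl mulr_ge0// surv_ge0.
Qed.

(** Two limits: N to infinity in [le_sum_sub_surv] bounds each E[min(tau, t)] by the expectation,
    then t to infinity removes the error [a * surv t]. *)
Lemma expected_tau_ge v (c F a : R) :
  (forall t, \sum_(k < t) surv R k [set v] <= c) ->
  (forall t, F <= \sum_(k < t) surv R k [set v] + a * surv R t [set v]) ->
  (F%:E <= expected_tau R v)%E.
Proof.
move=> sc Fs; rewrite (expected_tauE _ _ sc).
have h0 t : (0 <= (t%:R * hit R t [set v])%:E)%E.
  by rewrite lee_fin mulr_ge0// hit_ge0.
set A := (X in (_ <= X)%E).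
have s0 := surv_cvg0 _ _ sc.
have sA t : ((\sum_(k < t) surv R k [set v])%:E <= A)%E.
  have A0 : (0 <= A)%E by apply: nneseries_ge0 => k _ _; exact: h0.
  have : (A < +oo)%E.
    apply: le_lt_trans (ltry c).
    by rewrite /A -(expected_tauE _ _ sc) expected_tau_le.
  have partial N : (\sum_(0 <= k < N) (k%:R * hit R k [set v])%:E <= A)%E.
    by apply: nneseries_lim_ge => k _ _; exact: h0.
  move: A A0 partial; case=> // a' _ partial _; rewrite lee_fin.
  apply: (@ler_cvg_to _ \oo _ _ (fun=> \sum_(k < t) surv R k [set v])
     (fun N => a' + t%:R * surv R N [set v])); first exact: cvg_cst.
    rewrite -[X in _ --> X](addr0 a') -[X in _ + X](mulr0 t%:R).
    by apply: cvgD; [exact: cvg_cst|by apply: cvgMl_tmp].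
  exists t => // N /= tN; rewrite -lerBlDr.
  apply: le_trans (le_sum_sub_surv _ _ _ tN) _.
  by have := partial N.+1; rewrite sumEFin lee_fin big_mkord sum_mul_hit.
move: A sA => [r| |]; [|by rewrite leey|by move=> /(_ 0%N)].
move=> sA; rewrite lee_fin.
apply: (@ler_cvg_to _ \oo _ _ (fun=> F) (fun t => r + a * surv R t [set v])).
- exact: cvg_cst.
- rewrite -[X in _ --> X](addr0 r) -[X in _ + X](mulr0 a).
  by apply: cvgD; [exact: cvg_cst|by apply: cvgMl_tmp].
- by apply: nearW => t; apply: le_trans (Fs t) _; rewrite lerD2r -lee_fin.
Qed.

End ExpectedTime.

(** * Starts that can color everything *)

Section Potential.
Variables (R : realType) (G : digraph).
Implicit Types (B C : {set G}) (v w u : G).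

Lemma force_prob_neq0 B w :
  force_prob R B w != 0 -> in_nbrs w :&: B != set0.
Proof.
by apply: contraNneq => wB0; rewrite /force_prob wB0 cards0 mul0r if_same.
Qed.

Lemma path_prob_ge0 v t (b : t.+1.-tuple {set G}) : 0 <= path_prob R v b.
Proof.
by rewrite mulr_ge0 ?ler0n// prodr_ge0// => i _; exact: rzf_step_ge0.
Qed.

(** Otherwise no arc leaves [B], and by induction every trajectory of positive probability stays
    inside [B] and never reaches the whole vertex set. *)
Lemma can_color_all_boundary v B : can_color_all R v -> v \in B ->
  B != [set: G] -> exists2 w, w \notin B & in_nbrs w :&: B != set0.
Proof.
move=> [t]; rewrite lt0r => /andP[sum0 _] vB BT.
have [b /eqP bT] : exists2 b : t.+1.-tuple {set G},
    tnth b ord_max == [set: G] & path_prob R v b != 0.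
  apply: contrapT => nb; move/eqP: sum0; apply; apply: big1 => b bT.
  by apply/eqP; apply: contrapT => /negP pb; apply: nb; exists b.
rewrite mulf_eq0 pnatr_eq0 eqb0 negb_or negbK => /andP[/eqP b0 /prodf_neq0 bP].
apply: contrapT => nw; suff bB k : (k <= t)%N -> nth set0 b k \subset B.
  move/negP: BT; apply; rewrite -subTset -bT (tnth_nth set0); exact: bB.
elim: k => [_|k IH kt]; first by rewrite b0 sub1set.
have [_ forced] := rzf_step_neq0 _ _ _ _ (bP (Ordinal kt) isT).
apply/subsetP => w wk; apply: contrapT => /negP wB; apply: nw; exists w => //.
have sB := IH (ltnW kt).
have := force_prob_neq0 _ _ (forced w wk (contraNN (subsetP sB w) wB)).
by apply: contraNN; rewrite -!subset0; apply: subset_trans (setIS _ sB).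
Qed.


(** Otherwise every P(tau = t) vanishes, although these probabilities sum to 1. *)
Lemma can_color_all_of_surv v (c : R) :
  (forall t, \sum_(k < t) surv R k [set v] <= c) -> can_color_all R v.
Proof.
move=> sc; apply: contrapT => nv.
have h0 t : hit R t [set v] = 0.
  apply/eqP; apply: contrapT => /negP h0; apply: nv; exists t.
  apply: (@lt_le_trans _ _ (hit R t [set v])); first by rewrite lt0r h0 hit_ge0.
  rewrite -tau_pmfE /tau_pmf /rzf_prob [leLHS]big_mkcond [leRHS]big_mkcond/=.
  apply: ler_sum => b _; case: ifPn => [/forallP/(_ ord_max)|_].
    by rewrite eqxx => /eqP ->.
  by case: ifP => // _; exact: path_prob_ge0.
have := sum_hit_eq1 _ _ _ _ sc.
rewrite eseries0 => [/esym/eqP|t _ _]; last by rewrite h0.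
by rewrite eqe oner_eq0.
Qed.

Lemma ept_lty_can_color : (ept R G < +oo)%E -> exists v : G, can_color_all R v.
Proof.
apply: contraPP => /forallNP nc; apply/negP; rewrite -leNgt.
by apply: le_bigmin => // v _; rewrite /ept_from asboolF.
Qed.

End Potential.

(* The largest possible expected time to color [w] white vertices when the
   maximum indegree is [d]: with [i] white vertices left, some white vertex is
   forced with probability at least [1 / minn i d]. *)
Definition max_time (d w : nat) : nat := \sum_(i < w) minn i.+1 d.

Lemma max_time_S d w : max_time d w.+1 = (max_time d w + minn w.+1 d)%N.
Proof. by rewrite /max_time big_ord_recr. Qed.

Lemma leq_max_time d w w' : (w <= w')%N -> (max_time d w <= max_time d w')%N.
Proof.
elim: w' => [|w' IH]; first by rewrite leqn0 => /eqP->.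
rewrite leq_eqVlt ltnS => /predU1P[->//|/IH] le_ww'.
by rewrite max_time_S (leq_trans le_ww') ?leq_addr.
Qed.

(** At w = n - 1 this is the closed form dn - d(d+1)/2. *)
Lemma max_timeE (R : realType) d w : (d <= w)%N ->
  (max_time d w)%:R = d%:R * w.+1%:R - d%:R * (d%:R + 1) / 2%:R :> R.
Proof.
elim: w => [|w IH].
  by rewrite leqn0 => /eqP->; rewrite /max_time big_ord0; field.
rewrite leq_eqVlt ltnS => /predU1P[->|dw].
  (* When [d] equals [w.+1] each minimum is [i.+1], and the sum is a triangular number. *)
  suff -> : (max_time w.+1 w.+1)%:R = w.+1%:R * w.+2%:R / 2%:R :> R.
    by rewrite -!natr1; field.
  rewrite /max_time (eq_bigr (fun i : 'I_w.+1 => i.+1)); last first.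
    by move=> i _; apply/minn_idPl.
  elim: w.+1 => [|k IHk]; first by rewrite big_ord0 !mul0r.
  by rewrite big_ord_recr natrD IHk /= -!natr1; field.
by rewrite max_time_S natrD IH// (minn_idPr (leqW dw)) -!natr1; field.
Qed.

(** If [u] turns blue, the white count drops by at least one, so at least the top summand of
    [max_time] is lost. *)
Lemma max_time_setC (G : digraph) (d : nat) (B C : {set G}) (u : G) :
  u \notin B -> B \subset C ->
  (max_time d #|~: C| + minn #|~: B| d * (u \in C) <= max_time d #|~: B|)%N.
Proof.
move=> uB sBC; case: (boolP (u \in C)) => uC; last first.
  by rewrite muln0 addn0 leq_max_time// subset_leq_card// setCS.
rewrite muln1; have : (#|~: C| < #|~: B|)%N.
  apply: proper_card; rewrite properE setCS sBC/=.
  by apply/subsetPn; exists u; rewrite !inE ?uC ?negbK.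
case: #|~: B| => // w; rewrite ltnS max_time_S leq_add2r.
exact: leq_max_time.
Qed.

Lemma leq_indeg (G : digraph) (w : G) : (indeg w <= max_indeg G)%N.
Proof. exact: leq_bigmax. Qed.

Lemma in_nbrs_irr (G : digraph) (w : G) : w \notin in_nbrs w.
Proof. by rewrite inE arc_irr. Qed.

Lemma max_indeg_ltn_card (G : digraph) (v : G) : (max_indeg G < #|G|)%N.
Proof.
have lt_indeg (w : G) : (indeg w < #|G|)%N.
  rewrite /indeg -cardsT proper_card// properT.
  apply: contraNneq (in_nbrs_irr G w).
  by move=> ->; rewrite inE.
have : (0 < #|G|)%N by apply/card_gt0P; exists v.
case E : #|G| => [//|n] _; rewrite ltnS; apply/bigmax_leqP => w _.
by rewrite -ltnS -E.
Qed.

(* The in-neighbours of a white vertex [u] are blue, or among the white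
   vertices other than [u]. *)
Lemma le1_minn_force_prob (R : realType) (G : digraph) (B : {set G}) (u : G) :
  u \notin B -> in_nbrs u :&: B != set0 ->
  1 <= (minn #|~: B| (max_indeg G))%:R * force_prob R B u.
Proof.
move=> uB; rewrite -card_gt0 => b0; have := leq_indeg _ u.
have := cardsID B (in_nbrs u); rewrite -/(indeg u).
have : (#|in_nbrs u :\: B| < #|~: B|)%N.
  apply: proper_card; rewrite properE; apply/andP; split.
    by apply/subsetP => w; rewrite !inE => /andP[].
  by apply/subsetPn; exists u; rewrite !inE ?uB// arc_irr andbF.
rewrite /force_prob; set b := #|_ :&: _| in b0 *; set c := #|_ :\: _|.
move: (indeg u) #|~: B| (max_indeg G) => i w d cw bc id.
have i0 : (0 < i)%N by lia.
rewrite gtn_eqF// mulrA ler_pdivlMr ?ltr0n// mul1r -natrM ler_nat.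
(* With i = b + c, b >= 1 and c <= w - 1: i <= wb because (w - 1)(b - 1) >= 0, and i <= d <= db. *)
by rewrite /minn; case: ifP => _; nia.
Qed.

(** * Upper bound for every digraph *)

Section Bounds.
Variables (R : realType) (G : digraph).
Implicit Types (B C : {set G}) (v w u : G).

Lemma sum_surv_le_max_time v t : can_color_all R v ->
  \sum_(k < t) surv R k [set v] <= (max_time (max_indeg G) #|G|.-1)%:R.
Proof.
move=> cv; set d := max_indeg G.
pose f (B : {set G}) : R := (max_time d #|~: B|)%:R.
have -> : (max_time d #|G|.-1)%:R = f [set v] by rewrite /f cardsC1.
apply: (@sum_surv_le _ _ [pred B : {set G} | v \in B]) => /=.
(* The invariant is that [v] is blue, which is what [can_color_all_boundary] asks of a state. *)
- by move=> B C vB /rzf_step_neq0[/subsetP/(_ _ vB)].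
- by move=> B; rewrite ler0n.
- move=> B vB BT; have [u uB uB0] := can_color_all_boundary _ _ _ _ cv vB BT.
  have := sum_rzf_step_mem_sub R G B u (f B) (minn #|~: B| d)%:R uB.
  have := le1_minn_force_prob R G B u uB uB0.
  rewrite -/d => le1 sumE.
  apply: (@le_trans _ _ (f B - (minn #|~: B| d)%:R * force_prob R B u));
    last by lra.
  rewrite -sumE; apply: le_sum_rzf_step => C /rzf_step_neq0[sBC _].
  by rewrite lerBrDr -natrM -natrD ler_nat max_time_setC.
- by rewrite set11.
Qed.

Lemma ept_from_le_max_time v : can_color_all R v ->
  (ept_from R v <= (max_time (max_indeg G) #|G|.-1)%:R%:E)%E.
Proof.
move=> cv; rewrite /ept_from asboolT//.
by apply: expected_tau_le => t; exact: sum_surv_le_max_time.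
Qed.

Lemma ept_le_max_time : (ept R G < +oo)%E ->
  (ept R G <= (max_time (max_indeg G) #|G|.-1)%:R%:E)%E.
Proof.
move=> /ept_lty_can_color[v cv].
exact: le_trans (bigmin_le _ _ _) (ept_from_le_max_time v cv).
Qed.

End Bounds.

(** * The extremal chain *)

Section ChainGraph.
Variables (n d : nat).

(** The order is [n.+1], so [n] counts the white vertices at the start; the condition [0 < j] keeps
    vertex 0 a source. *)
Definition chain_arc : rel 'I_n.+1 :=
  fun i j => (i.+1 == j) || (0 < j < i)%N && (i < j + d)%N.

Lemma chain_arc_irr : irreflexive chain_arc.
Proof. by move=> i; rewrite /chain_arc; lia. Qed.

Definition chain_graph : digraph := Digraph chain_arc_irr.

Definition seg (k : nat) : {set chain_graph} := [set i : 'I_n.+1 | (i <= k)%N].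

Lemma chain_indeg0 : indeg (ord0 : chain_graph) = 0.
Proof. by apply/eqP; rewrite cards_eq0 -subset0; apply/subsetP => i; rewrite !inE. Qed.

Lemma chain_indeg (j : chain_graph) : (0 < d)%N -> (0 < (j : 'I_n.+1))%N ->
  indeg j = minn d (n.+1 - (j : 'I_n.+1)).
Proof.
move: j => /= j d0 j0.
(* [h] enumerates the in-neighbours: 0 gives the predecessor of [j], and x > 0 the successor j +
   x. *)
pose h (x : 'I_(minn d (n.+1 - j))) : 'I_n.+1 :=
  inord (if x == 0%N :> nat then j.-1 else (j + x)%N).
have hE x : h x = (if x == 0%N :> nat then j.-1 else (j + x)%N) :> nat.
  by rewrite inordK//; case: x => x /= xlt; have := ltn_ord j; case: eqP; lia.
have h_inj : injective h.
  move=> x y /(congr1 val); rewrite /= !hE => hxy; apply/val_inj => /=.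
  by move: hxy; do 2 case: eqP; lia.
rewrite -[RHS]card_ord -(card_imset _ h_inj); apply: eq_card => i.
rewrite inE/= /chain_arc; apply/idP/imsetP => [ij|[x _ ->]]; last first.
  by rewrite hE; have := ltn_ord x; case: (eqVneq (x : nat) 0%N); lia.
have xlt : ((if i < j then 0 else i - j) < minn d (n.+1 - j))%N.
  by have := ltn_ord i; have := ltn_ord j; case: ifP; lia.
exists (Ordinal xlt) => //; apply/val_inj; rewrite /= hE /=.
case: (ltnP i j) ij {xlt} => /= ltij ij; first by lia.
by case: (eqVneq (i - j)%N 0%N); lia.
Qed.

Lemma chain_max_indeg : (d <= n)%N -> (0 < d)%N || (n == 0%N) ->
  max_indeg chain_graph = d.
Proof.
move=> dn d0n; apply/eqP; rewrite eqn_leq; apply/andP; split.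
  apply/bigmax_leqP => /= j _; case: (posnP (j : 'I_n.+1)) => j0.
    by rewrite (_ : j = ord0) ?chain_indeg0//; apply/val_inj.
  move/orP: d0n => [d0|/eqP n0]; first by rewrite chain_indeg// geq_minl.
  by have := ltn_ord j; move: j0; lia.
case: (posnP d) => [->//|d0].
(* Vertex 1 attains the maximum, as its indegree is min(d, n) = d. *)
pose j : 'I_n.+1 := inord 1; have jE : j = 1%N :> nat by rewrite inordK; lia.
by apply: leq_trans (leq_indeg _ (j : chain_graph)); rewrite chain_indeg ?jE//; lia.
Qed.

Lemma card_setC_seg k : (k <= n)%N -> #|~: seg k| = (n - k)%N.
Proof.
move=> kn; have hP (x : 'I_(n - k)) : (k.+1 + x < n.+1)%N.
  by have := ltn_ord x; lia.
have h_inj : injective (fun x => Ordinal (hP x)).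
  by move=> x y /(congr1 val) /= /addnI xy; apply/val_inj.
rewrite -[RHS]card_ord -(card_imset _ h_inj); apply: eq_card => i.
rewrite !inE -ltnNge; apply/idP/imsetP => [ki|[x _ ->]]; last by rewrite /=; lia.
have xlt : (i - k.+1 < n - k)%N by have := ltn_ord i; lia.
by exists (Ordinal xlt) => //; apply/val_inj => /=; lia.
Qed.

Lemma segT : seg n = [set: chain_graph].
Proof. by apply/setP => i; rewrite !inE -ltnS ltn_ord. Qed.

(** Backward arcs never leave an initial segment, so the only arc out of it goes from k to k + 1. *)
Lemma chain_nbrs_seg k (w : chain_graph) : w \notin seg k ->
  in_nbrs w :&: seg k =
  if (w : 'I_n.+1) == k.+1 :> nat then [set (inord k : 'I_n.+1)] else set0.
Proof.
rewrite inE -ltnNge => kw; have := ltn_ord (w : 'I_n.+1) => wn.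
have kE : (inord k : 'I_n.+1) = k :> nat by rewrite inordK; lia.
apply/setP => i; rewrite !inE /= /chain_arc; case: ifP => /eqP wk; rewrite inE.
  by rewrite -(inj_eq val_inj) /= kE; lia.
by lia.
Qed.

Variable R : realType.

Lemma chain_step k C : rzf_step R (seg k) C != 0 -> C = seg k \/
  exists2 u : chain_graph, u \in C /\ u \notin seg k & C = seg k.+1.
Proof.
move=> /rzf_step_neq0[sC forced].
have next (w : chain_graph) : w \in C -> w \notin seg k -> (w : 'I_n.+1) = k.+1 :> nat.
  move=> wC wk; have := force_prob_neq0 _ _ _ _ (forced w wC wk).
  by rewrite chain_nbrs_seg//; case: ifP => [/eqP//|_]; rewrite eqxx.
have [sCk|/subsetPn[u uC uk]] := boolP (C \subset seg k).
  by left; apply/eqP; rewrite eqEsubset sCk.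
right; exists u => //; apply/setP => w; have := next _ uC uk => uE.
have [wk|wk] := boolP (w \in seg k).
  by rewrite (subsetP sC)//; move: wk; rewrite !inE => /leqW->.
apply/idP/idP => [wC|]; first by rewrite inE (next _ wC wk).
move: wk; rewrite !inE -ltnNge => kw wk; rewrite (_ : w = u)//.
by apply/val_inj => /=; lia.
Qed.

Let f (B : {set chain_graph}) : R := (max_time d #|~: B|)%:R.

(** Vertex k + 1 has one blue in-neighbour among min(d, n - k); forcing it has probability 1 /
    min(d, n - k) and lowers the potential by min(d, n - k). *)
Lemma chain_drift k : (k < n)%N -> (0 < d)%N ->
  \sum_C rzf_step R (seg k) C * f C = f (seg k) - 1.
Proof.
move=> kn d0; pose u : 'I_n.+1 := inord k.+1.
have uE : u = k.+1 :> nat by rewrite inordK.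
have uk : (u : chain_graph) \notin seg k by rewrite inE uE ltnn.
have uk1 : (u : chain_graph) \in seg k.+1 by rewrite inE uE.
have := sum_rzf_step_mem_sub R chain_graph _ _ (f (seg k)) (minn (n - k) d)%:R uk.
rewrite /force_prob chain_nbrs_seg// uE eqxx cards1 chain_indeg ?uE//.
rewrite subSS minnC gtn_eqF ?leq_min ?d0 ?subn_gt0//.
rewrite mul1r mulfV ?pnatr_eq0 -?lt0n ?leq_min ?d0 ?subn_gt0// => <-.
apply: eq_bigr => C _.
have [->|/chain_step step] := eqVneq (rzf_step R (seg k) C) 0.
  by rewrite !mul0r.
congr (_ * _); case: step => [->|[w _ ->]].
  by rewrite (negPf uk) mulr0 subr0.
have fS : max_time d (n - k) =
    (max_time d (n - k.+1) + minn d (n - k))%N.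
  by rewrite -[in LHS](subnSK kn) max_time_S subnSK// minnC.
rewrite uk1 mulr1 /f (card_setC_seg k.+1 kn).
by rewrite (card_setC_seg k (ltnW kn)) fS natrD addrK.
Qed.

Lemma chain_ept : (d <= n)%N -> (0 < d)%N || (n == 0%N) ->
  ept R chain_graph = (max_time d n)%:R%:E.
Proof.
move=> dn d0n; set v0 : chain_graph := ord0.
have seg0 : [set v0] = seg 0 by apply/setP => i; rewrite !inE leqn0 -val_eqE.
have fv0 : (max_time d n)%:R = f [set v0].
  by rewrite /f seg0 card_setC_seg// subn0.
pose I := [pred B : {set chain_graph} | [exists k : 'I_n.+1, B == seg k]].
have Iv0 : I [set v0] by apply/existsP; exists ord0; rewrite seg0.
have Istep B C : I B -> rzf_step R B C != 0 -> I C.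
  move=> /existsP[k /eqP->] /chain_step[->|[u [_ uk] ->]].
    by apply/existsP; exists k.
  have kn : (k.+1 < n.+1)%N.
    by move: uk; rewrite inE -ltnNge; have := ltn_ord (u : 'I_n.+1); lia.
  by apply/existsP; exists (Ordinal kn).
have drift B : I B -> B != [set: chain_graph] ->
    \sum_C rzf_step R B C * f C = f B - 1.
  move=> /existsP[k /eqP->] BT; have kn : (k < n)%N.
    rewrite ltn_neqAle -ltnS ltn_ord andbT; apply: contraNneq BT => ->.
    by rewrite segT.
  by apply: chain_drift => //; lia.
have upper t : \sum_(k < t) surv R k [set v0] <= (max_time d n)%:R.
  rewrite fv0; apply: (@sum_surv_le _ _ I) => // B IB BT.
  by rewrite drift.
have cv0 := can_color_all_of_surv _ _ _ _ upper.
(* From another start, the complement of [v0] would need an arc into [v0], which has none. *)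
have ncv v : v != v0 -> ~ can_color_all R v.
  move=> vv0 cv; have [||w] := can_color_all_boundary _ _ _ (~: [set v0]) cv.
  - by rewrite !inE.
  - by apply/eqP => /setP/(_ v0); rewrite !inE eqxx.
  rewrite !inE negbK => /eqP-> /set0Pn[i].
  by rewrite inE (_ : in_nbrs v0 = set0) ?inE//; apply/cards0_eq/chain_indeg0.
apply/le_anti/andP; split.
  apply: le_trans (bigmin_le _ v0 _) _; rewrite /ept_from asboolT//.
  exact: expected_tau_le.
apply: le_bigmin => [|v _]; first exact: leey.
rewrite /ept_from; case: asboolP => [cv|_]; last exact: leey.
have [->|/ncv//] := eqVneq v v0.
(* [max_time d n.+1] bounds the potential of every set, including the empty one. *)
apply: (expected_tau_ge _ _ _ _ _ (max_time d n.+1)%:R upper) => t.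
rewrite fv0; apply: (@le_sum_surv _ _ I) => // [B||B IB BT].
- rewrite ler_nat leq_max_time// -[X in (_ <= X)%N]card_ord; exact: max_card.
- by rewrite /f setCT cards0 /max_time big_ord0.
- by rewrite drift.
Qed.

End ChainGraph.

(** * The maximum over all admissible digraphs *)

Theorem corollary4p6 (R : realType) (n d : nat) :
  (exists G : digraph, admissible R n d G) ->
  let m : \bar R := (d%:R * n%:R - d%:R * (d%:R + 1) / 2%:R)%:E in
  (exists G : digraph, admissible R n d G /\ ept R G = m) /\
  (forall G : digraph, admissible R n d G -> (ept R G <= m)%E).
Proof.
move=> [G [<- <- fin]] /=; have [v cv] := ept_lty_can_color _ _ fin.
have := max_indeg_ltn_card G v.
case cardG : #|G| => [//|k]; rewrite ltnS => dk.
rewrite -max_timeE//; split.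
  (* With more than one vertex, leaving the state {v} requires a vertex of positive indegree. *)
  have d0 : (0 < max_indeg G)%N || (k == 0%N).
    case: (posnP k) => [_|k0]; rewrite ?orbT ?orbF//.
    have [||w _] := can_color_all_boundary _ _ _ [set v] cv; first exact: set11.
      by apply: contraTneq k0 => vT; rewrite -leqNgt -ltnS -cardG -cardsT -vT cards1.
    rewrite -card_gt0 => w0; rewrite (leq_trans _ (leq_indeg _ w))//.
    by apply: leq_trans w0 _; rewrite subset_leq_card// subsetIl.
  have eptE := chain_ept _ _ R dk d0.
  exists (chain_graph k (max_indeg G)); split => //; split.
  - by rewrite card_ord.
  - exact: chain_max_indeg.
  - by rewrite eptE ltry.
by move=> H [cardH dH finH]; have := ept_le_max_time _ _ finH; rewrite cardH dH.
Qed.
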